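(* Let $\mathcal{P}\subseteq\mathbb{R}^D$ have linear span equal to $\mathbb{R}^D$, $\mathcal{U}=\mathcal{P}\times\mathbb{R}^m$, let $f:\mathcal{U}^+\to\mathbb{R}^r$ have a GCR, and let $L\in\mathbb{N}$. If $\mathrm{rank}\,H_{f,L,L}=\mathrm{rank}\,H_f$, then the ALPV $\Sigma$ computed by the Kalman-Ho algorithm from $H_{f,L,L+1}$ (described in the context) is a minimal realization of $f$. The condition $\mathrm{rank}\,H_{f,L,L}=\mathrm{rank}\,H_f$ holds if there exists an ALPV realization $\Sigma$ of $f$ such that $\dim\Sigma\le L+1$.
   Context: Fix positive integers $D,m,r$, put $Q=\{1,\dots,D\}$. For a set $X$, $X^+$ denotes the set of finite non-empty sequences of elements of $X$, $X^*=X^+\cup\{\epsilon\}$ with $\epsilon$ the empty sequence, $|v|$ is the length of $v$ ($|\epsilon|=0$), and $vw$ denotes concatenation. $\mathbb{N}$ contains $0$. ALPV. For $\mathcal{P}\subseteq\mathbb{R}^D$ (scheduling space), a discrete-time affine LPV system (ALPV) $\Sigma=(r,m,n,\mathcal{P},\{(A_q,B_q,C_q)\}_{q=1}^D)$ consists of $n\in\mathbb{N}$ and matrices $A_q\in\mathbb{R}^{n\times n}$, $B_q\in\mathbb{R}^{n\times m}$, $C_q\in\mathbb{R}^{r\times n}$, $q\in Q$, and has dynamics $$x(t+1)=\sum_{q=1}^D (A_qx(t)+B_qu(t))p_q(t),\qquad y(t)=\sum_{q=1}^D C_qx(t)p_q(t),$$ with $p(t)=(p_1(t),\dots,p_D(t))\in\mathcal{P}$,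 $u(t)\in\mathbb{R}^m$. Its dimension is $\dim\Sigma=n$. Its input-output map $y_\Sigma:\mathcal{U}^+\to\mathbb{R}^r$ sends $w=(p(0),u(0))\cdots(p(t),u(t))$ to the output $y(t)$ at time $t$ when $x(0)=0$ and the scheduling values and inputs in $w$ are applied. $\Sigma$ is a realization of $f$ if $f=y_\Sigma$; it is a minimal realization of $f$ if moreover $\dim\Sigma\le\dim\hat\Sigma$ for every ALPV realization $\hat\Sigma$ of $f$ (same $r,m,\mathcal{P}$). GCR. $f$ has a generalized convolution representation (GCR) if there is a map $S^f:\{v\in Q^+:|v|>1\}\to\mathbb{R}^{r\times m}$ such that for every $w=(p(0),u(0))\cdots(p(t),u(t))\in\mathcal{U}^+$ $$f(w)=\sum_{k=0}^{t-1}\Big\{\sum_{v\in Q^+,|v|=t-k+1}S^f(v)\,\underline{p}_{k:t}^{v}\Big\}u(k),$$ where for $v=q_0\cdots q_{t-k}$, $\underline{p}_{k:t}^{v}=p_{q_0}(k)p_{q_1}(k+1)\cdots p_{q_{t-k}}(t)$. When $\mathcal{P}$ spans $\mathbb{R}^D$, $S^f$ is uniquely determined by $f$. Markov-parameters and Hankel-matrix. For $v\in Q^*$, $M^f(v)$ is the $rD\times mD$ matrix viewed as a $D\times D$ block matrix whose $(i,j)$ block is $S^f(jvi)$, $i,j\in Q$. Order $Q^*$ by: $v\prec s$ if $|v|<|s|$, or $|v|=|s|>0$, $v\neq s$ and at the first position where $v$ and $s$ differ the entry of $v$ is smaller; enumerate $Q^*=\{v_1,v_2,\dots\}$ with $v_1\prec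 v_2\prec\cdots$ (so $v_1=\epsilon$). $H_f$ is the infinite block matrix whose block in block row $i$ and block column $j$ ($i,j=1,2,\dots$) is $M^f(v_jv_i)$; its rank is the dimension of the linear span of its columns (possibly $+\infty$). For $L\in\mathbb{N}$ let $\mathbf{N}(L)=\sum_{j=0}^{L}D^j$ (the number of sequences in $Q^*$ of length at most $L$). $H_{f,L,M}$ denotes the upper-left $\mathbf{N}(L)rD\times\mathbf{N}(M)mD$ sub-matrix of $H_f$. Kalman-Ho algorithm. Let $n=\mathrm{rank}\,H_{f,L,L+1}$. Choose a factorization $H_{f,L,L+1}=\mathbf{O}\mathbf{R}$ with $\mathbf{O}\in\mathbb{R}^{rD\mathbf{N}(L)\times n}$, $\mathbf{R}\in\mathbb{R}^{n\times mD\mathbf{N}(L+1)}$, $\mathrm{rank}\,\mathbf{O}=\mathrm{rank}\,\mathbf{R}=n$. Let $\overline{\mathbf{R}}$ be the matrix formed by the first $\mathbf{N}(L)mD$ columns of $\mathbf{R}$. For $q\in Q$ let $\mathbf{R}_q$ be the $n\times\mathbf{N}(L)mD$ matrix whose $j$th $n\times mD$ block column ($j=1,\dots,\mathbf{N}(L)$) is the $k$th $n\times mD$ block column of $\mathbf{R}$, where $k$ is determined by $v_jq=v_k$. Define $\Sigma=(r,m,n,\mathcal{P},\{(A_q,B_q,C_q)\}_{q=1}^D)$ by: $\begin{bmatrix}B_1&\cdots&B_D\end{bmatrix}$ equals the first $mD$ columns of $\mathbf{R}$; $\begin{bmatrix}C_1^T&\cdots&C_D^T\end{bmatrix}^T$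 equals the first $rD$ rows of $\mathbf{O}$; $A_q=\mathbf{R}_q\overline{\mathbf{R}}^{+}$, where $\overline{\mathbf{R}}^{+}$ is the Moore-Penrose pseudoinverse of $\overline{\mathbf{R}}$. *)

(* Defs.v *)
From mathcomp Require Import all_boot all_order all_algebra.
From mathcomp Require Import boolp classical_sets functions reals.

Set Implicit Arguments.
Unset Strict Implicit.
Unset Printing Implicit Defensive.

Import Order.TTheory GRing.Theory Num.Theory.
Local Open Scope ring_scope.

Section Dimension.
Variables (R : realType) (E : lmodType R).

Definition lspan (A : set E) : set E :=
  [set x | exists n (a : 'I_n -> R) (b : 'I_n -> E),
     (forall i, A (b i)) /\ x = \sum_(i < n) a i *: b i].

Definition lin_indep n (b : 'I_n -> E) : Prop :=
  forall a : 'I_n -> R, \sum_(i < n) a i *: b i = 0 -> forall i, a i = 0.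

Definition has_dim (V : set E) (n : nat) : Prop :=
  exists b : 'I_n -> E, lin_indep b /\ lspan (range b) = V.

(* [None] stands for an infinite dimension; see [ldimP]. *)
Definition ldim (V : set E) : option nat :=
  if `[< exists n, has_dim V n >] then Some (xget 0%N [set n | has_dim V n])
  else None.

Lemma lspan_range n (b : 'I_n -> E) x :
  lspan (range b) x -> exists a : 'I_n -> R, x = \sum_(i < n) a i *: b i.
Proof.
case=> k [a [c [cb ->]]].
have /choice [g gP] : forall i, exists j, b j = c i.
  by move=> i; case: (cb i) => j _ <-; exists j.
exists (fun j => \sum_(i < k | g i == j) a i).
rewrite (partition_big g xpredT) //=; apply: eq_bigr => j _.
by rewrite scaler_suml; apply: eq_bigr => i /eqP <-; rewrite gP.
Qed.

Lemma lspan_mem (A : set E) x : A x -> lspan A x.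
Proof.
move=> Ax; exists 1%N, (fun=> 1), (fun=> x); split=> //.
by rewrite big_ord1 scale1r.
Qed.

Lemma lin_indep_le n k (b : 'I_n -> E) (c : 'I_k -> E) : lin_indep b ->
  (forall i, lspan (range c) (b i)) -> (n <= k)%N.
Proof.
move=> ib bc; have /choice [g gP] := fun i => lspan_range (bc i).
pose M := \matrix_(i < n, j < k) g i j.
suff /eqP rM : row_free M by have := rank_leq_col M; rewrite rM.
rewrite -kermx_eq0; apply/rowV0P => u /sub_kermxP uM0.
apply/rowP => i; rewrite mxE; apply: (ib (fun i => u 0 i)).
under eq_bigr do rewrite gP scaler_sumr.
rewrite exchange_big big1 //= => j _.
under eq_bigr do rewrite scalerA.
rewrite -scaler_suml; move/rowP/(_ j): uM0; rewrite !mxE => uM0.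
have -> : \sum_i u 0 i * g i j = \sum_i u 0 i * M i j.
  by apply: eq_bigr => l _; rewrite mxE.
by rewrite uM0 scale0r.
Qed.

Lemma ldimP (V : set E) n : ldim V = Some n <-> has_dim V n.
Proof.
rewrite /ldim; split=> [|Vn].
  by case: asboolP => // Vex [<-]; exact: (@xgetPex _ 0%N [set k | has_dim V k] Vex).
have Vex : exists n, has_dim V n by exists n.
rewrite asboolT //; congr Some.
have [b [ib bV]] := Vn; have [c [ic cV]] := @xgetPex _ 0%N [set k | has_dim V k] Vex.
apply/eqP; rewrite eqn_leq; apply/andP; split.
  by apply: (lin_indep_le (c := b) ic) => i; rewrite bV -cV; apply: lspan_mem; exists i.
by apply: (lin_indep_le (c := c) ib) => i; rewrite cV -bV; apply: lspan_mem; exists i.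
Qed.

End Dimension.

Section MoorePenrose.
Variables (R : realType).

Definition penrose a b (A : 'M[R]_(a, b)) (X : 'M[R]_(b, a)) : Prop :=
  [/\ A *m X *m A = A, X *m A *m X = X,
      (A *m X)^T = A *m X & (X *m A)^T = X *m A].

(* The Moore-Penrose pseudoinverse: see [mp_pinvP] and [penrose_unique]; the
   default 0 is never used. *)
Definition mp_pinv a b (A : 'M[R]_(a, b)) : 'M[R]_(b, a) :=
  xget 0 [set X | penrose A X].

Lemma gram_unit a b (A : 'M[R]_(a, b)) : row_free A -> A *m A^T \in unitmx.
Proof.
move=> fA; rewrite -row_free_unit -kermx_eq0.
apply/rowV0P => u /sub_kermxP uAA.
suff uA0 : u *m A = 0 by apply/eqP; rewrite -(mulmx_free_eq0 u fA) uA0.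
have : (u *m A) *m (u *m A)^T = 0.
  by rewrite trmx_mul mulmxA -(mulmxA u) uAA mul0mx.
move: (u *m A) => x.
move/matrixP/(_ 0 0); rewrite !mxE => /eqP.
rewrite psumr_eq0 => [|i _]; last by rewrite mxE -expr2 sqr_ge0.
move/allP=> h; apply/rowP => i.
have := h i (mem_index_enum _).
by rewrite /= mxE -expr2 sqrf_eq0 [RHS]mxE => /eqP.
Qed.

Lemma penrose_full a k b (C : 'M[R]_(a, k)) (B : 'M[R]_(k, b)) :
  row_full C -> row_free B ->
  penrose (C *m B)
    (B^T *m invmx (B *m B^T) *m (invmx (C^T *m C) *m C^T)).
Proof.
move=> fC fB; have uB := gram_unit fB.
have uC : C^T *m C \in unitmx.
  by have := @gram_unit _ _ C^T; rewrite trmxK; apply; rewrite /row_free mxrank_tr.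
set Y := invmx (B *m B^T); set Z := invmx (C^T *m C).
have YT : Y^T = Y by rewrite trmx_inv trmx_mul trmxK.
have ZT : Z^T = Z by rewrite trmx_inv trmx_mul trmxK.
have BY : B *m (B^T *m Y) = 1%:M by rewrite mulmxA mulmxV.
have ZC : (Z *m C^T) *m C = 1%:M by rewrite -mulmxA mulVmx.
have AX : (C *m B) *m (B^T *m Y *m (Z *m C^T)) = C *m (Z *m C^T).
  by rewrite !mulmxA -(mulmxA C) -(mulmxA C) -(mulmxA B) BY mulmx1.
have XA : (B^T *m Y *m (Z *m C^T)) *m (C *m B) = B^T *m Y *m B.
  by rewrite mulmxA -(mulmxA _ _ C) ZC mulmx1.
split.
- by rewrite AX mulmxA -(mulmxA C) ZC mulmx1.
- by rewrite XA mulmxA -(mulmxA _ B) BY mulmx1.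
- by rewrite AX !trmx_mul trmxK ZT mulmxA.
- by rewrite XA !trmx_mul trmxK YT mulmxA.
Qed.

Lemma mp_pinvP a b (A : 'M[R]_(a, b)) : penrose A (mp_pinv A).
Proof.
apply: (@xgetPex _ 0 [set X | penrose A X]).
have := penrose_full (col_base_full A) (row_base_free A).
by rewrite mulmx_base => h; eexists; exact: h.
Qed.

Lemma penrose_unique a b (A : 'M[R]_(a, b)) X Y :
  penrose A X -> penrose A Y -> X = Y.
Proof.
move=> [x1 x2 x3 x4] [y1 y2 y3 y4].
have e : Y *m A = X *m A.
  rewrite -y4 -{1}x1 -[A *m X *m A]mulmxA mulmxA trmx_mul x4 y4.
  by rewrite mulmxA -[X *m A *m Y]mulmxA -[LHS]mulmxA y1.
have e' : A *m Y = A *m X.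
  rewrite -y3 -{1}x1 -[_ *m Y]mulmxA trmx_mul y3 x3.
  by rewrite mulmxA y1.
by rewrite -x2 -e -mulmxA -e' mulmxA y2.
Qed.

End MoorePenrose.

Section Words.
Variable D : nat.
Implicit Types v s : seq 'I_D.

(* Letters 1,...,D are encoded as 0,...,D-1. *)
Definition shortlex v s : bool :=
  (size v < size s)%N ||
  (size v == size s) && ((v : seqlexi 'I_D) < s)%O.

Fixpoint words (l : nat) : seq (seq 'I_D) :=
  if l is l'.+1 then [seq q :: v | q <- enum 'I_D, v <- words l'] else [:: [::]].

Definition words_le (L : nat) : seq (seq 'I_D) :=
  flatten [seq words l | l <- iota 0 L.+1].

(* The enumeration of all words along [shortlex], starting at index 0 with the
   empty word, and its inverse; see [word_mono], [word_idxK] and [wordK].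
   The list [words_le k] has at least [k.+1] elements when D > 0. *)
Definition word (k : nat) : seq 'I_D := nth [::] (words_le k) k.

Definition word_idx v : nat := index v (words_le (size v)).

Definition Nw (L : nat) : nat := (\sum_(j < L.+1) D ^ j)%N.

Lemma Nw_gt0 L : (0 < Nw L)%N.
Proof. by rewrite /Nw big_ord_recl expn0. Qed.

Lemma NwS L : Nw L.+1 = (Nw L + D ^ L.+1)%N.
Proof. by rewrite /Nw big_ord_recr. Qed.

Lemma leq_Nw L K : (L <= K)%N -> (Nw L <= Nw K)%N.
Proof.
elim: K => [|K IH]; first by rewrite leqn0 => /eqP ->.
rewrite leq_eqVlt => /predU1P[->//|/IH h].
by rewrite NwS (leq_trans h) // leq_addr.
Qed.

Lemma words_leS L : words_le L.+1 = words_le L ++ words L.+1.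
Proof. by rewrite /words_le -addn1 iotaD map_cat flatten_cat /= cats0. Qed.

Lemma size_words l : size (words l) = (D ^ l)%N.
Proof.
by elim: l => //= l IH; rewrite size_allpairs IH size_enum_ord expnS.
Qed.

Lemma size_words_le L : size (words_le L) = Nw L.
Proof.
elim: L => [|L IH]; first by rewrite /Nw big_ord1.
by rewrite words_leS size_cat IH NwS size_words.
Qed.

Lemma mem_words l v : (v \in words l) = (size v == l).
Proof.
elim: l v => [|l IH] v; first by rewrite inE -size_eq0.
apply/allpairsP/idP => [[[q s] /= [_ + ->]]|]; first by rewrite IH.
by case: v => //= q v sv; exists (q, v); rewrite mem_enum IH.
Qed.

Lemma mem_words_le L v : (v \in words_le L) = (size v <= L)%N.
Proof.
elim: L => [|L IH]; first by rewrite inE leqn0 -size_eq0.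
by rewrite words_leS mem_cat IH mem_words orbC -leq_eqVlt.
Qed.

Lemma shortlex_irr : irreflexive shortlex.
Proof. by move=> v; rewrite /shortlex ltnn ltxx andbF. Qed.

Lemma shortlex_trans : transitive shortlex.
Proof.
move=> b a c; rewrite /shortlex.
case/orP=> [h|/andP[/eqP ab l]]; case/orP=> [h'|/andP[/eqP bc l']].
- by rewrite (ltn_trans h h').
- by rewrite -bc h.
- by rewrite ab h'.
- by rewrite ab bc eqxx (lt_trans l l') orbT.
Qed.

Lemma words_sorted l : pairwise shortlex (words l).
Proof.
elim: l => //= l IH.
have : pairwise (fun i j : 'I_D => (i < j)%N) (enum 'I_D).
  by rewrite -(pairwise_map val ltn) val_enum_ord -sorted_pairwise
    ?iota_ltn_sorted//; apply: ltn_trans.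
elim: (enum 'I_D) => //= q qs IHq /andP[qlt /IHq {}IHq].
rewrite pairwise_cat IHq andbT; apply/andP; split.
  apply/allrelP => v s /mapP[v' + ->] /allpairsP[[q' s'] /= [qq + ->]].
  rewrite !mem_words => /eqP sv /eqP ss; rewrite /shortlex /= sv ss eqxx.
  have qq' : (q < q')%O := allP qlt _ qq; rewrite Order.SeqLexiOrder.ltxi_cons.
  by rewrite (ltW qq') [(q' <= q)%O]leNgt qq' orbT.
rewrite pairwise_map; apply: sub_pairwise IH => v s /=.
by rewrite /shortlex /= ltnS eqSS Order.SeqLexiOrder.ltxi_cons !lexx.
Qed.

Lemma words_le_sorted L : pairwise shortlex (words_le L).
Proof.
elim: L => [|L IH] //; rewrite words_leS pairwise_cat IH words_sorted !andbT.
apply/allrelP => v s; rewrite mem_words_le mem_words => vL /eqP sL.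
by rewrite /shortlex sL ltnS vL.
Qed.

Lemma words_le_uniq L : uniq (words_le L).
Proof.
by apply: pairwise_uniq (words_le_sorted L); apply: shortlex_irr.
Qed.

Lemma words_le_nth L K k :
  (L <= K)%N -> (k < Nw L)%N -> nth [::] (words_le K) k = nth [::] (words_le L) k.
Proof.
elim: K => [|K IH]; first by rewrite leqn0 => /eqP ->.
rewrite leq_eqVlt => /predU1P[->//|LK] kL.
by rewrite words_leS nth_cat size_words_le (leq_trans kL (leq_Nw (LK : (L <= K)%N))) IH.
Qed.

Lemma word_nth L k : (0 < D)%N -> (k < Nw L)%N ->
  word k = nth [::] (words_le L) k.
Proof.
move=> D0 kL; have kk : (k < Nw k)%N.
  elim: (k) => [|k' IH]; first exact: Nw_gt0.
  by rewrite NwS -addn1 (leq_add IH) // expn_gt0 D0.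
rewrite /word; case/orP: (leq_total L k) => h.
  exact: words_le_nth.
by rewrite (words_le_nth h).
Qed.

Lemma size_word L k : (0 < D)%N -> (k < Nw L)%N -> (size (word k) <= L)%N.
Proof.
by move=> D0 kL; rewrite (word_nth D0 kL) -mem_words_le mem_nth ?size_words_le.
Qed.

Lemma word_idx_lt v L : (size v <= L)%N -> (word_idx v < Nw L)%N.
Proof.
move=> vL; apply: leq_trans (leq_Nw vL).
by rewrite /word_idx -size_words_le index_mem mem_words_le.
Qed.

Lemma word_idxK : (0 < D)%N -> cancel word_idx word.
Proof.
move=> D0 v; rewrite (word_nth D0 (word_idx_lt (leqnn (size v)))).
by rewrite nth_index // mem_words_le.
Qed.

Lemma word_mono : (0 < D)%N ->
  {mono word : i j / (i < j)%N >-> shortlex i j}.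
Proof.
move=> D0.
have homo i j : (i < j)%N -> shortlex (word i) (word j).
  move=> ij; have jj : (j < Nw j)%N.
    elim: (j) => [|k' IH]; first exact: Nw_gt0.
    by rewrite NwS -addn1 (leq_add IH) // expn_gt0 D0.
  rewrite (word_nth D0 jj) (word_nth D0 (ltn_trans ij jj)).
  have /(pairwiseP [::]) := words_le_sorted j.
  by apply; rewrite ?inE ?size_words_le // (ltn_trans ij).
move=> i j; case: (ltngtP i j) => [/homo ->//|/homo ji|->].
  apply/negP => ij; have := shortlex_trans ij ji.
  by rewrite shortlex_irr.
exact: shortlex_irr.
Qed.

Lemma wordK : (0 < D)%N -> cancel word word_idx.
Proof.
move=> D0 k; have := word_idxK D0 (word k).
case: (ltngtP (word_idx (word k)) k) => // h e.
  by have := word_mono D0 (word_idx (word k)) k; rewrite h e shortlex_irr.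
by have := word_mono D0 k (word_idx (word k)); rewrite h e shortlex_irr.
Qed.

End Words.

Section ALPV.
Variables (R : realType) (D m r : nat).

(* The scheduling space is not a record field but the parameter P of [alpv_io], since
   the matrices do not depend on it. *)
Record alpv := Alpv {
  alpv_dim : nat;
  mA : 'I_D -> 'M[R]_alpv_dim;
  mB : 'I_D -> 'M[R]_(alpv_dim, m);
  mC : 'I_D -> 'M[R]_(r, alpv_dim) }.

Variable P : set 'cV[R]_D.

Definition letter : Type := (P * 'cV[R]_m)%type.

(* A non-empty sequence of letters of length [t.+1] carries times 0,...,t. *)
Definition io_map : Type := forall t : nat, t.+1.-tuple letter -> 'cV[R]_r.

Section Signals.
Variables (t : nat) (w : t.+1.-tuple letter).

(* Only used for k <= t. *)
Definition sched (k : nat) (q : 'I_D) : R := \val (tnth w (inord k)).1 q 0.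
Definition inp (k : nat) : 'cV[R]_m := (tnth w (inord k)).2.

Fixpoint state (Sg : alpv) (k : nat) : 'cV[R]_(alpv_dim Sg) :=
  if k is k'.+1 then
    \sum_(q < D) sched k' q *: (mA Sg q *m state Sg k' + mB Sg q *m inp k')
  else 0.

End Signals.

Definition alpv_io (Sg : alpv) : io_map := fun t w =>
  \sum_(q < D) sched w t q *: (mC Sg q *m state w Sg t).

Definition realization (f : io_map) (Sg : alpv) : Prop :=
  forall t (w : t.+1.-tuple letter), f t w = alpv_io Sg w.

Definition minimal_realization (f : io_map) (Sg : alpv) : Prop :=
  realization f Sg /\
  forall Sg' : alpv, realization f Sg' -> (alpv_dim Sg <= alpv_dim Sg')%N.

(* S is total for convenience: its values on words of length at most 1 are
   irrelevant, both here and in the Hankel matrix below. *)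
Definition is_gcr (f : io_map) (S : seq 'I_D -> 'M[R]_(r, m)) : Prop :=
  forall t (w : t.+1.-tuple letter),
    f t w = \sum_(k < t)
      (\sum_(v : (t - k).+1.-tuple 'I_D)
         (\prod_(i < (t - k).+1) sched w (k + i) (tnth v i)) *: S v)
      *m inp w k.

End ALPV.

Section KalmanHo.
Variables (R : realType) (D m r : nat).

(* The products r * D and m * D, in the form used by [\mxblock]. *)
Notation rD := (\sum_(q < D) r)%N.
Notation mD := (\sum_(q < D) m)%N.

Section Hankel.
Variable S : seq 'I_D -> 'M[R]_(r, m).

Definition markov (v : seq 'I_D) : 'M[R]_(rD, mD) :=
  \mxblock_(i < D, j < D) S (j :: rcons v i).

Definition hankel (i j : nat) : 'M[R]_(rD, mD) :=
  markov (word D j ++ word D i).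

(* A column of the infinite matrix, as the sequence of its blocks of height r * D. *)
Definition hankel_col (j : nat) (b : 'I_mD) : nat -> 'cV[R]_rD :=
  fun i => col b (hankel i j).

Definition hankel_rank : option nat :=
  ldim (lspan [set x | exists j b, x = hankel_col j b]).

(* The upper-left corner with Nw D L block rows and Nw D M block columns. *)
Definition hankel_sub (L M : nat) :
    'M[R]_(\sum_(i < Nw D L) rD, \sum_(j < Nw D M) mD) :=
  \mxblock_(i < Nw D L, j < Nw D M) hankel i j.

End Hankel.

Lemma word_succ_lt L (q : 'I_D) (j : 'I_(Nw D L)) :
  (word_idx (rcons (word D j) q) < Nw D L.+1)%N.
Proof.
apply: word_idx_lt; rewrite size_rcons ltnS size_word //.
exact: leq_trans (ltn_ord q).
Qed.

(* The index k with v_j q = v_k; see [word_idxK]. *)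
Definition word_succ L (q : 'I_D) (j : 'I_(Nw D L)) : 'I_(Nw D L.+1) :=
  Ordinal (word_succ_lt q j).

Variables (L n : nat).
Variables (O : 'M[R]_(\sum_(i < Nw D L) rD, n)).
Variables (Rm : 'M[R]_(n, \sum_(j < Nw D L.+1) mD)).

Definition Rbar : 'M[R]_(n, \sum_(j < Nw D L) mD) :=
  \mxrow_(j < Nw D L) submxrow Rm (widen_ord (leq_Nw D (leqnSn L)) j).

Definition Rshift (q : 'I_D) : 'M[R]_(n, \sum_(j < Nw D L) mD) :=
  \mxrow_(j < Nw D L) submxrow Rm (word_succ q j).

Definition kalman_ho : alpv R D m r := {|
  alpv_dim := n;
  mA := fun q => Rshift q *m mp_pinv Rbar;
  mB := fun q => submxrow (submxrow Rm (Ordinal (Nw_gt0 D L.+1))) q;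
  mC := fun q => submxcol (submxcol O (Ordinal (Nw_gt0 D L))) q |}.

End KalmanHo.

(* Main.v *)
(* Since P spans R^D, peeling off one letter at a time shows that the
   convolution kernel of f is unique, so an ALPV realizes f iff its matrices
   satisfy S(j v i) = C_i A_v B_j, where A_v is the product of the A_q along v.

   If rank H_{L,L} = rank H, the block columns of index at most N(L) span all the
   columns of H, and a combination of them vanishes as soon as its first N(L)
   block rows do. Relations between columns are preserved by the shift
   c_v -> c_{vq}, which on the first N(L) block columns is Rbar -> R_q in the
   coordinates given by O; hence A_q Rbar = R_q, then O A_v B is the truncated
   block column of index v for every word v, and its first block row yields
   S(j v i) = C_i A_v B_j. Any other realization factors H_{L,L+1} through its
   state space, which gives minimality.

   If f has a realization of dimension at most L+1, the spaces spanned by the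
   rows of C A_v with |v| <= k grow strictly until they are stationary, so they
   are stationary from k = L on; likewise for A_v B. Hence H_{L,L} determines
   the rank of H. *)
Require Import Defs.
From mathcomp Require Import all_boot all_order all_algebra.
From mathcomp Require Import boolp classical_sets functions reals.
Local Open Scope ring_scope.

Set Implicit Arguments.
Unset Strict Implicit.
Unset Printing Implicit Defensive.
Import Order.TTheory GRing.Theory Num.Theory.
Local Open Scope classical_set_scope.

(** * Sums over words weighted by scheduling values *)

Section WordSums.
Variables (R : realType) (D : nat).

(** The inner sum of a GCR as a recursion on the first letter, so that letters can be peeled off one
    at a time. *)
Fixpoint wsum (E : lmodType R) (l : nat) (p : nat -> 'I_D -> R)
    (T : seq 'I_D -> E) : E :=
  if l is l'.+1 then
    \sum_(q < D) p 0%N q *: wsum l' (fun i => p i.+1) (fun v => T (q :: v))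
  else T [::].

Lemma wsumS (E : lmodType R) l p (T : seq 'I_D -> E) : wsum l.+1 p T =
  \sum_(q < D) p 0%N q *: wsum l (fun i => p i.+1) (fun v => T (q :: v)).
Proof. by []. Qed.

Lemma wsumE (E : lmodType R) l (p : nat -> 'I_D -> R) (T : seq 'I_D -> E) :
  \sum_(v : l.-tuple 'I_D) (\prod_(i < l) p i (tnth v i)) *: T v = wsum l p T.
Proof.
elim: l p T => [|l IH] p T /=.
  rewrite (big_pred1 ([tuple] : 0.-tuple 'I_D)) => [|v].
    by rewrite big_ord0 scale1r.
  by rewrite [v]tuple0 /= eqxx.
have cons_bij : {on [pred _ | true],
    bijective (fun x : 'I_D * l.-tuple 'I_D => [tuple of x.1 :: x.2])}.
  apply: onW_bij; exists (fun v => (thead v, [tuple of behead v])).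
    by case=> q v /=; congr pair; apply: val_inj.
  by move=> v; rewrite -tuple_eta.
rewrite (reindex _ cons_bij) /=.
rewrite -(pair_bigA _ (fun q (v : l.-tuple 'I_D) =>
  (\prod_(i < l.+1) p i (tnth [tuple of q :: v] i)) *: T (q :: v))) /=.
apply: eq_bigr => q _; rewrite -IH scaler_sumr; apply: eq_bigr => v _.
rewrite scalerA big_ord_recl tnth0; congr (_ * _ *: _).
by apply: eq_bigr => i _; rewrite tnthS.
Qed.

Lemma eq_wsum (E : lmodType R) l p p' (T T' : seq 'I_D -> E) :
  (forall i, (i < l)%N -> p i =1 p' i) -> (forall v, size v = l -> T v = T' v) ->
  wsum l p T = wsum l p' T'.
Proof.
elim: l p p' T T' => [|l IH] p p' T T' pp TT /=; first exact: TT.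
apply: eq_bigr => q _; rewrite pp //; congr (_ *: _).
by apply: IH => [i il|v vl]; [apply: pp|apply: TT; rewrite /= vl].
Qed.

Lemma wsum_mulmx a b c l p (T : seq 'I_D -> 'M[R]_(a, b)) (N : 'M_(b, c)) :
  wsum l p (fun v => T v *m N) = wsum l p T *m N.
Proof.
elim: l p T => [|l IH] p T //=; rewrite mulmx_suml.
by apply: eq_bigr => q _; rewrite IH scalemxAl.
Qed.

Lemma wsumB (E : lmodType R) l p (T T' : seq 'I_D -> E) :
  wsum l p (fun v => T v - T' v) = wsum l p T - wsum l p T'.
Proof.
elim: l p T T' => [|l IH] p T T' //=; rewrite -sumrB.
by apply: eq_bigr => q _; rewrite IH scalerBr.
Qed.

Lemma span_nonempty (P : set 'cV[R]_D) : (0 < D)%N -> lspan P = setT ->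
  exists x, P x.
Proof.
(* The all-ones vector is nonzero since [D] is positive, so its expansion has at least one term. *)
move=> D0 Ps; have : lspan P (const_mx 1) by rewrite Ps.
case=> [[|n]] [a [b [Pb e]]]; last by exists (b ord0).
move: e => /colP/(_ (Ordinal D0))/eqP.
by rewrite big_ord0 !mxE oner_eq0.
Qed.

(** Induction on the length: as [P] spans, the unit vector of the first letter is a combination of
    points of [P], and by linearity it may replace the first scheduling value. *)
Lemma wsum_eq0 (E : lmodType R) (P : set 'cV[R]_D) l (T : seq 'I_D -> E) :
  (0 < D)%N -> lspan P = setT ->
  (forall p : nat -> 'cV[R]_D, (forall i, P (p i)) ->
     wsum l (fun i q => p i q 0) T = 0) ->
  forall v, size v = l -> T v = 0.
Proof.
move=> D0 Ps; have [x0 Px0] := span_nonempty D0 Ps.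
elim: l T => [|l IH] T T0 v.
  by move/size0nil ->; apply: (T0 (fun=> x0)).
case: v => //= q v [vl]; apply: (IH (fun v => T (q :: v))) => // p Pp.
have : lspan P (delta_mx q 0) by rewrite Ps.
case=> n [a [b [Pb e]]].
have aux i : \sum_q' b i q' 0 *:
    wsum l (fun i q => p i q 0) (fun v => T (q' :: v)) = 0.
  by apply: (T0 (fun k => if k is k'.+1 then p k' else b i)) => -[|k] //=.
have : \sum_q' (delta_mx q 0 : 'cV[R]_D) q' 0 *:
    wsum l (fun i q => p i q 0) (fun v => T (q' :: v)) = 0.
  rewrite e; under eq_bigr do rewrite summxE scaler_suml.
  rewrite exchange_big big1 //= => i _.
  under eq_bigr do rewrite mxE -scalerA.
  by rewrite -scaler_sumr aux scaler0.
rewrite (bigD1 q) //= big1 => [|q' qq]; first by rewrite mxE !eqxx scale1r addr0.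
by rewrite mxE (negbTE qq) scale0r.
Qed.

End WordSums.

(** * Uniqueness of the kernel and the kernel of an ALPV *)

Section Gcr.
Variables (R : realType) (D m r : nat) (P : set 'cV[R]_D).
Implicit Types (f : io_map m r P) (S : seq 'I_D -> 'M[R]_(r, m)).
Implicit Types (Sg : alpv R D m r) (v : seq 'I_D).

Lemma gcrE f S : is_gcr f S <-> forall t (w : t.+1.-tuple (letter m P)),
  f t w = \sum_(k < t)
    wsum (t - k).+1 (fun i q => sched w (k + i) q) S *m inp w k.
Proof.
split=> fS t w; rewrite fS; apply: eq_bigr => k _; congr (_ *m _).
  by rewrite -wsumE.
by rewrite -wsumE.
Qed.

Lemma eq_gcr f S S' : is_gcr f S ->
  (forall v, (1 < size v)%N -> S v = S' v) -> is_gcr f S'.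
Proof.
move=> /gcrE fS SS; apply/gcrE => t w; rewrite fS; apply: eq_bigr => k _.
congr (_ *m _); apply: eq_wsum => // v vt; apply: SS.
by rewrite vt ltnS subn_gt0.
Qed.

Lemma gcr_unique f S S' v : (0 < D)%N -> lspan P = setT ->
  is_gcr f S -> is_gcr f S' -> (1 < size v)%N -> S v = S' v.
Proof.
move=> D0 Ps /gcrE fS /gcrE fS' v1; apply/matrixP => i b.
suff : (S v - S' v) *m delta_mx b (0 : 'I_1) = 0.
  rewrite -colE => /colP/(_ i); rewrite !mxE => /eqP.
  by rewrite subr_eq0 => /eqP.
apply: (wsum_eq0 (T := fun v => (S v - S' v) *m delta_mx b (0 : 'I_1))
  (l := size v) D0 Ps) => // p Pp.
rewrite wsum_mulmx.
case: (size v) v1 => [|[|t]] // _.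
(* A unit input at time 0 followed by zero inputs leaves only the term k = 0, a sum over words of
   length t+2. *)
pose w : t.+2.-tuple (letter m P) := [tuple
  (exist _ (p i) (mem_set (Pp i)), if i == 0 :> nat then delta_mx b 0 else 0)
  | i < t.+2].
have inp0 : inp w 0 = delta_mx b 0 by rewrite /inp tnth_mktuple inordK.
have inpS (k : 'I_t) : inp w (lift ord0 k) = 0.
  by rewrite /inp tnth_mktuple inordK // !ltnS ltnW // ltn_ord.
have schedE (k : nat) q : (k < t.+2)%N -> sched w k q = p k q 0.
  by move=> kt; rewrite /sched tnth_mktuple /= inordK.
have fw S0 : \sum_(k < t.+1)
    wsum (t.+1 - k).+1 (fun i q => sched w (k + i) q) S0 *m inp w k =
    wsum t.+2 (fun i q => sched w i q) S0 *m delta_mx b 0.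
  rewrite big_ord_recl inp0 big1 ?addr0 // => k _.
  by rewrite inpS mulmx0.

have -> : wsum t.+2 (fun i q => p i q 0) (fun v => S v - S' v) =
    wsum t.+2 (fun i q => p i q 0) S - wsum t.+2 (fun i q => p i q 0) S'.
  exact: wsumB.
suff eqW S0 : wsum t.+2 (fun i q => p i q 0) S0 *m delta_mx b (0 : 'I_1) =
    wsum t.+2 (fun i q => sched w i q) S0 *m delta_mx b (0 : 'I_1).
  by rewrite mulmxBl !eqW -!fw -fS -fS' subrr.
by congr (_ *m _); apply: eq_wsum => // k kt q; rewrite schedE.
Qed.

(* The value at the empty word is junk: kernels are only compared on words of
   length at least 2. *)
Fixpoint out_word Sg v : 'M[R]_(r, alpv_dim Sg) :=
  match v with
  | [::] => 0
  | [:: q] => mC Sg q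
  | q :: v' => out_word Sg v' *m mA Sg q
  end.

Definition alpv_markov Sg v : 'M[R]_(r, m) :=
  if v is q :: v' then out_word Sg v' *m mB Sg q else 0.

(* The first letter of a word acts first, so the product is reversed. *)
Fixpoint trans_word Sg v : 'M[R]_(alpv_dim Sg) :=
  if v is q :: v' then trans_word Sg v' *m mA Sg q else 1%:M.

Lemma out_word_rcons Sg v i :
  out_word Sg (rcons v i) = mC Sg i *m trans_word Sg v.
Proof.
elim: v => [|q v IH] /=; first by rewrite mulmx1.
by rewrite mulmxA -IH; case: v {IH}.
Qed.

Lemma alpv_markovE Sg j v i : alpv_markov Sg (j :: rcons v i) =
  mC Sg i *m trans_word Sg v *m mB Sg j.
Proof. by rewrite /= out_word_rcons. Qed.

Lemma trans_word_cat Sg v s :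
  trans_word Sg (s ++ v) = trans_word Sg v *m trans_word Sg s.
Proof. by elim: s => [|q s IH] /=; rewrite ?mulmx1 // IH mulmxA. Qed.

Lemma trans_word_rcons Sg v q :
  trans_word Sg (rcons v q) = mA Sg q *m trans_word Sg v.
Proof. by rewrite -cats1 trans_word_cat /= mul1mx. Qed.

(** Induction on the time [k]: [Y k] applied to the state at time [k] collects the effect at time
    [t] of the inputs before [k]; for [k = t] this is the output. *)
Lemma alpv_gcr Sg : is_gcr (@alpv_io R D m r P Sg) (alpv_markov Sg).
Proof.
apply/gcrE => t w; rewrite /alpv_io.
(* [Y k] is the output map at time [t] as a function of the state at time [k]. *)
pose Y k : 'M[R]_(r, alpv_dim Sg) :=
  wsum (t - k).+1 (fun i q => sched w (k + i) q) (out_word Sg).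
pose A k : 'M[R]_(alpv_dim Sg) := \sum_(q < D) sched w k q *: mA Sg q.
pose B k : 'M[R]_(alpv_dim Sg, m) := \sum_(q < D) sched w k q *: mB Sg q.
have YA k : (k < t)%N -> Y k = Y k.+1 *m A k.
  move=> kt; rewrite /Y /A subnS prednK ?subn_gt0 //.
  have : (0 < t - k)%N by rewrite subn_gt0.
  case: (t - k)%N => // l _; rewrite mulmx_sumr wsumS.
  apply: eq_bigr => q _; rewrite addn0 -scalemxAr; congr (_ *: _).
  rewrite -wsum_mulmx; apply: eq_wsum => [i _ q'|[|q' v]] //.
  by rewrite addSnnS.
have YB k : (k < t)%N -> wsum (t - k).+1 (fun i q => sched w (k + i) q)
    (alpv_markov Sg) = Y k.+1 *m B k.
  move=> kt; rewrite /Y /B subnS prednK ?subn_gt0 // mulmx_sumr.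
  apply: eq_bigr => q _; rewrite addn0 -scalemxAr; congr (_ *: _).
  rewrite -wsum_mulmx; apply: eq_wsum => [i _ q'|v] //.
  by rewrite addSnnS.
have Yt : Y t = \sum_q sched w t q *: mC Sg q.
  by rewrite /Y subnn /= addn0.
under [LHS]eq_bigr do rewrite scalemxAl.
rewrite -mulmx_suml -Yt.
under [RHS]eq_bigr do rewrite YB //.
suff stateE k : (k <= t)%N -> Y k *m state w Sg k =
    \sum_(j < k) Y j.+1 *m B j *m inp w j by exact: stateE.
elim: k => [|k IH] kt; first by rewrite mulmx0 big_ord0.
rewrite big_ord_recr /= -IH ?(ltnW kt) // (YA k) // -!mulmxA -mulmxDr.
congr (_ *m _); rewrite !mulmx_suml -big_split /=.
by apply: eq_bigr => q _; rewrite scalerDr !scalemxAl.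
Qed.

Lemma realizationP f S Sg : (0 < D)%N -> lspan P = setT -> is_gcr f S ->
  realization f Sg <->
  forall v i j, S (j :: rcons v i) =
    mC Sg i *m trans_word Sg v *m mB Sg j.
Proof.
move=> D0 Ps fS; split=> [fSg v i j|SE t w].
  rewrite -alpv_markovE; apply: gcr_unique (fS) _ _ => //; last first.
    by rewrite /= size_rcons.
  by move=> t w; rewrite fSg; apply: alpv_gcr.
rewrite (alpv_gcr Sg w); apply: (eq_gcr fS) => v.
by case: v => // j v; case/lastP: v => // v i _; rewrite alpv_markovE.
Qed.

End Gcr.

(** * Dimension of a span compared with the rank of a matrix of truncated vectors *)

Section SpanRank.
Variables (R : realType) (E : lmodType R).

Lemma lspan_sub b (g : 'I_b -> E) (A : set E) :
  A `<=` lspan (range g) -> lspan A `<=` lspan (range g).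
Proof.
move=> Ag x [n [a [c [Ac ->]]]].
have /choice [h hP] : forall i, exists h : 'I_b -> R, c i = \sum_j h j *: g j.
  by move=> i; apply/lspan_range/Ag.
exists b, (fun j => \sum_i a i * h i j), g; split=> [i|]; first by exists i.
under eq_bigr do rewrite hP scaler_sumr.
rewrite exchange_big; apply: eq_bigr => j _; rewrite scaler_suml.
by apply: eq_bigr => i _; rewrite scalerA.
Qed.

Variables (a b : nat) (M : 'M[R]_(a, b)) (g : 'I_b -> E).

Definition lincomb (u : 'cV[R]_b) : E := \sum_(i < b) u i 0 *: g i.

Lemma lincomb_span u : lspan (range g) (lincomb u).
Proof. by exists b, (u ^~ 0), g; split=> // i; exists i. Qed.

Lemma lincombB u v : lincomb (u - v) = lincomb u - lincomb v.
Proof.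
rewrite /lincomb -sumrB; apply: eq_bigr => i _.
by rewrite !mxE scalerBl.
Qed.

Lemma lincomb_delta i : lincomb (delta_mx i 0) = g i.
Proof.
rewrite /lincomb (bigD1 i) //= big1 => [|j ji].
  by rewrite mxE !eqxx scale1r addr0.
by rewrite mxE (negbTE ji) scale0r.
Qed.

Lemma lincomb_mul k (G : 'M[R]_(b, k)) (c : 'cV_k) :
  lincomb (G *m c) = \sum_l c l 0 *: lincomb (col l G).
Proof.
under [RHS]eq_bigr do rewrite scaler_sumr.
rewrite exchange_big; apply: eq_bigr => i _; rewrite !mxE scaler_suml.
by apply: eq_bigr => l _; rewrite scalerA !mxE mulrC.
Qed.

(* [M] maps the columns of [pinvmx (row_base M)] to those of [col_base M]. *)
Definition rank_basis (l : 'I_(\rank M)) : E :=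
  lincomb (col l (pinvmx (row_base M))).

Lemma mul_pinv_row_base c (u : 'M[R]_(_, c)) :
  M *m (pinvmx (row_base M) *m u) = col_base M *m u.
Proof.
by rewrite mulmxA -[X in X *m pinvmx _]mulmx_base (mulmxKp (row_base_free M)).
Qed.

Lemma mul_col_base_eq0 c (u : 'M[R]_(_, c)) : col_base M *m u = 0 -> u = 0.
Proof.
by move=> e; apply: (row_full_inj (col_base_full M)); rewrite e mulmx0.
Qed.

Hypothesis rel : forall u, lincomb u = 0 -> M *m u = 0.

(** [rel] carries a relation among these vectors to one among the independent columns of
    [col_base M]. *)
Lemma rank_basis_indep : lin_indep rank_basis.
Proof.
move=> c c0; suff /colP e : \col_l c l = 0.
  by move=> i; have := e i; rewrite !mxE.
apply/mul_col_base_eq0; rewrite -mul_pinv_row_base; apply: rel.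
by rewrite lincomb_mul -[RHS]c0; apply: eq_bigr => l _; rewrite mxE.
Qed.

(** When [g] and the columns of [M] satisfy the same relations, sending [g i] to column [i] is an
    isomorphism onto the column space of [M]. *)
Lemma has_dim_rank : (forall u, M *m u = 0 -> lincomb u = 0) ->
  has_dim (lspan (range g)) (\rank M).
Proof.
move=> rel'; exists rank_basis; split; first exact: rank_basis_indep.
apply/seteqP; split; apply: lspan_sub => _ [i _ <-].
  exact: lincomb_span.
(* Coordinates of column [i] of [M] in the columns of [col_base M]. *)
pose c := row_base M *m (delta_mx i 0 : 'cV_b).
exists (\rank M), (c ^~ 0), rank_basis.
split=> [l|]; first by exists l.
rewrite -lincomb_mul; apply/eqP; rewrite -subr_eq0 -{1}(lincomb_delta i).
rewrite -lincombB; apply/eqP/rel'.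
by rewrite mulmxBr mul_pinv_row_base mulmxA mulmx_base subrr.
Qed.

Section Spanning.
Variable V : set E.
Hypothesis gV : forall i, V (g i).
Hypothesis dimV : has_dim V (\rank M).

(** The coordinate matrix [G] of [rank_basis] in a basis [e] of [V] is square and row free, so its
    inverse rewrites [e]-coordinates in terms of [rank_basis]. *)
Lemma rank_basis_spans x : V x ->
  exists c, x = lincomb (pinvmx (row_base M) *m c).
Proof.
have [e [ie eV]] := dimV => Vx.
have gE i : lspan (range e) (g i) by rewrite eV.
have hE l : lspan (range e) (rank_basis l).
  apply: lspan_sub (lincomb_span _) => _ [i _ <-]; exact: gE.
have /choice [h hP] := fun l => lspan_range (hE l).
pose G := \matrix_(l, j) h l j.
have : row_free G.
  rewrite -kermx_eq0; apply/rowV0P => u /sub_kermxP uG0.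
  apply/rowP => l; rewrite mxE; apply: (rank_basis_indep (a := fun l => u 0 l)).
  under eq_bigr do rewrite hP scaler_sumr.
  rewrite exchange_big big1 //= => j _.
  under eq_bigr do rewrite scalerA.
  rewrite -scaler_suml; move/rowP/(_ j): uG0; rewrite !mxE => uG0.
  rewrite (eq_bigr (fun k => u 0 k * G k j)) ?uG0 ?scale0r // => k _.
  by rewrite mxE.
rewrite row_free_unit => uG.
move: Vx; rewrite -eV => /lspan_range [y ->].
exists ((\row_j y j *m invmx G)^T); rewrite lincomb_mul.
rewrite [RHS](eq_bigr (fun l => \sum_j
  (((\row_j y j *m invmx G) 0 l * G l j) *: e j))) => [|l _]; last first.
  rewrite -/(rank_basis l) hP scaler_sumr; apply: eq_bigr => j _.
  by rewrite scalerA !mxE.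
rewrite exchange_big; apply: eq_bigr => j _; rewrite -scaler_suml.
have /rowP/(_ j) : \row_j y j *m invmx G *m G = \row_j y j by rewrite mulmxKV.
by rewrite !mxE => ->.
Qed.

(** Every vector of [V] is a combination of [rank_basis], which truncation sends to independent
    columns; so truncation is injective on [V]. *)
Lemma lincomb_eq0 u : M *m u = 0 -> lincomb u = 0.
Proof.
move=> Mu; have Vu : V (lincomb u).
  have [e [_ eV]] := dimV; rewrite -eV.
  by apply: lspan_sub (lincomb_span u) => _ [i _ <-]; rewrite eV.
have [c uc] := rank_basis_spans Vu.
have : M *m (u - pinvmx (row_base M) *m c) = 0.
  by apply: rel; rewrite lincombB -uc subrr.
rewrite mulmxBr Mu sub0r mul_pinv_row_base => /eqP; rewrite oppr_eq0 => /eqP.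
by move/mul_col_base_eq0 => c0; rewrite uc c0 mulmx0 /lincomb big1 // => i _;
  rewrite mxE scale0r.
Qed.

End Spanning.
End SpanRank.

(** * The rank condition as statements about finitely many block columns *)

Section HankelRank.
Variables (R : realType) (D m r : nat) (S : seq 'I_D -> 'M[R]_(r, m)).

Notation rD := (\sum_(q < D) r)%N.
Notation mD := (\sum_(q < D) m)%N.
Notation hankel := (hankel S).
Notation hankel_sub := (hankel_sub S).

Definition hankel_row (M i : nat) : 'M[R]_(rD, \sum_(j < Nw D M) mD) :=
  \mxrow_(j < Nw D M) hankel i j.

Lemma hankel_sub_rows L M :
  hankel_sub L M = \mxcol_(i < Nw D L) hankel_row M i.
Proof. exact: mxblockEv. Qed.

Definition hankel_gen (M : nat) (b : 'I_(\sum_(j < Nw D M) mD)) :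
  nat -> 'cV[R]_rD := fun i => col b (hankel_row M i).
Arguments hankel_gen : clear implicits.

Lemma hankel_gen_col M b :
  hankel_gen M b = hankel_col S (tagnat.sig1 b) (tagnat.sig2 b).
Proof. by apply/funext => i; rewrite /hankel_gen col_mxrow. Qed.

Lemma lincomb_hankel_gen M u :
  lincomb (hankel_gen M) u = fun i => hankel_row M i *m u.
Proof.
apply/funext => i; rewrite /lincomb fct_sumE; apply/colP => k.
by rewrite summxE mxE; apply: eq_bigr => b _; rewrite !mxE mulrC.
Qed.

Lemma hankel_sub_rel L M u : lincomb (hankel_gen M) u = 0 ->
  hankel_sub L M *m u = 0.
Proof.
rewrite lincomb_hankel_gen => /(congr1 (fun f : nat -> 'cV_rD => f _)) u0.
rewrite hankel_sub_rows mxcol_mul -[RHS]mxcol0; apply: eq_mxcol => i.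
exact: u0.
Qed.

(** Truncation maps the span of the first N(L) block columns onto the column space of
    [hankel_sub S L L]. The ranks agree exactly when that span is the whole column space and
    truncation is injective on it. *)
Lemma hankel_rank_reduction L :
  Some (\rank (hankel_sub L L)) = hankel_rank S <->
  (forall j, exists U, forall i, hankel i j = hankel_row L i *m U) /\
  (forall u : 'cV_ _, hankel_sub L L *m u = 0 -> forall i, hankel_row L i *m u = 0).
Proof.
split=> [/esym/ldimP dimH|[colU rowU]].
  have gV b : lspan [set x | exists j b, x = hankel_col S j b] (hankel_gen L b).
    by apply: lspan_mem; rewrite hankel_gen_col; eexists; eexists.
  have rel := @hankel_sub_rel L L.
  split=> [j|u /(lincomb_eq0 rel gV dimH)].
    have /choice [c cP] : forall b, exists c : 'cV_ _,
        hankel_col S j b = lincomb (hankel_gen L) c.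
      move=> b; have Vj : lspan [set x | exists j b, x = hankel_col S j b]
        (hankel_col S j b) by apply: lspan_mem; exists j, b.
      by have [c cE] := rank_basis_spans rel gV dimH Vj; eexists; exact: cE.
    exists (\matrix_(k, b) c b k 0) => i; apply/matrixP => k b.
    have := congr1 (fun f : nat -> 'cV_rD => f i k 0) (cP b).
    rewrite lincomb_hankel_gen [LHS]mxE => ->; rewrite !mxE.
    by apply: eq_bigr => l _; congr (_ * _); rewrite mxE.
  rewrite lincomb_hankel_gen => /(congr1 (fun f : nat -> 'cV_rD => f _)) u0 i.
  exact: u0.
apply/esym/ldimP.
have -> : lspan [set x | exists j b, x = hankel_col S j b] =
    lspan (range (hankel_gen L)).
  apply/seteqP; split; last first.
    move=> x [n [a [c [cg ->]]]]; exists n, a, c; split=> // i.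
    by have [b _ <-] := cg i; rewrite hankel_gen_col; eexists; eexists.
  apply: lspan_sub => _ [j [b ->]]; have [U UP] := colU j.
  suff -> : hankel_col S j b = lincomb (hankel_gen L) (col b U).
    exact: lincomb_span.
  rewrite lincomb_hankel_gen; apply/funext => i.
  by rewrite /hankel_col UP !colE mulmxA.
apply: has_dim_rank => u; first exact: hankel_sub_rel.
by move=> /rowU u0; rewrite lincomb_hankel_gen; apply/funext => i; exact: u0.
Qed.

End HankelRank.

(** * Correctness of the Kalman-Ho matrices *)

Section KalmanHo.
Variables (R : realType) (D m r : nat) (S : seq 'I_D -> 'M[R]_(r, m)).
Variables (L n : nat).
Variables (Om : 'M[R]_(\sum_(i < Nw D L) \sum_(q < D) r, n)).
Variables (Rm : 'M[R]_(n, \sum_(j < Nw D L.+1) \sum_(q < D) m)).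
Hypothesis D0 : (0 < D)%N.
Hypothesis rankE : Some (\rank (hankel_sub S L L)) = hankel_rank S.
Hypothesis n_rank : n = \rank (hankel_sub S L L.+1).
Hypothesis fact : hankel_sub S L L.+1 = Om *m Rm.
Hypothesis rank_Om : \rank Om = n.

Lemma Om_inj p : injective (@mulmx R _ _ p Om).
Proof. by apply: row_full_inj; rewrite /row_full rank_Om. Qed.

Lemma Om_col j : Om *m submxrow Rm j = \mxcol_(i < Nw D L) hankel S i j.
Proof. by rewrite mul_submxrow -fact submxrow_matrix. Qed.

Lemma Om_Rbar : Om *m Rbar Rm = hankel_sub S L L.
Proof.
rewrite mul_mxrow [RHS]mxblockEh; apply: eq_mxrow => j.
exact: Om_col.
Qed.

(** Since (v_j q) v_i = v_j (q v_i), shifting block columns amounts to shifting block rows. *)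
Lemma Om_Rshift q : Om *m Rshift Rm q =
  \mxcol_(i < Nw D L) hankel_row S L (word_idx (q :: word D i)).
Proof.
rewrite mul_mxrow -mxblockEv mxblockEh; apply: eq_mxrow => j.
rewrite Om_col; apply: eq_mxcol => i.
by rewrite /hankel !word_idxK // cat_rcons.
Qed.

(** The columns of H_{L,L+1} are combinations of those of H_{L,L} = [Om *m Rbar Rm], so [n] is at
    most the rank of [Rbar Rm]. *)
Lemma Rbar_free : row_free (Rbar Rm).
Proof.
have [/choice [U UP] _] := (hankel_rank_reduction S L).1 rankE.
rewrite /row_free eqn_leq rank_leq_row {1}n_rank.
have -> : hankel_sub S L L.+1 =
    hankel_sub S L L *m \mxrow_(j < Nw D L.+1) U j.
  rewrite (hankel_sub_rows S L L) mul_mxcol_mxrow; apply: eq_mxblock => i j.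
  exact: UP.
by rewrite -Om_Rbar -mulmxA (leq_trans (mxrankM_maxr _ _)) // mxrankM_maxl.
Qed.

Lemma kalman_ho_shift q : mA (kalman_ho Om Rm) q *m Rbar Rm = Rshift Rm q.
Proof.
have [_ rowU] := (hankel_rank_reduction S L).1 rankE.
have [XR _ _ _] := mp_pinvP (Rbar Rm).
(* Independent rows make the pseudoinverse a right inverse. *)
have RX : Rbar Rm *m mp_pinv (Rbar Rm) = 1%:M.
  by apply: (row_free_inj Rbar_free); rewrite /= XR mul1mx.
rewrite /=; apply/eqP; rewrite -subr_eq0; apply/eqP.
apply: Om_inj; rewrite mulmx0 mulmxBr -(mulmxA (Rshift Rm q)) (mulmxA Om).
rewrite -[X in _ - X]mulmx1 -mulmxBr.
(* [Rbar Rm] annihilates [Y], so the columns of [Y] are relations among the columns of H_{L,L}. They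
   persist in every block row, in particular in those of the words q v_i that make up
   [Om *m Rshift Rm q]. *)
set Y := _ - 1%:M; apply/matrixP => x k; rewrite [RHS]mxE.
suff /colP/(_ x) : col k (Om *m Rshift Rm q *m Y) = 0.
  by move=> e; rewrite [LHS]mxE [RHS]mxE in e.
rewrite colE -(mulmxA (Om *m _)) -colE.
rewrite Om_Rshift mxcol_mul -[RHS]mxcol0; apply: eq_mxcol => i; apply: rowU.
rewrite -Om_Rbar -mulmxA colE (mulmxA (Rbar Rm) Y).
by rewrite /Y mulmxBr (mulmxA (Rbar Rm)) RX mul1mx mulmx1 subrr mul0mx mulmx0.
Qed.

Lemma kalman_ho_word v :
  Om *m (trans_word (kalman_ho Om Rm) v *m
    submxrow Rm (Ordinal (Nw_gt0 D L.+1))) =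
  \mxcol_(i < Nw D L) markov S (v ++ word D i).
Proof.
elim/last_ind: v => [|v q IH].
  by rewrite mul1mx Om_col; apply: eq_mxcol.
have [/choice [U UP] _] := (hankel_rank_reduction S L).1 rankE.
(* The block column of [v] may lie beyond the truncation, but it is a combination of the first N(L)
   ones; replacing [Rbar] by [Rshift] then appends [q] to [v]. *)
have vU : trans_word (kalman_ho Om Rm) v *m
    submxrow Rm (Ordinal (Nw_gt0 D L.+1)) = Rbar Rm *m U (word_idx v).
  apply: Om_inj; rewrite IH mulmxA Om_Rbar hankel_sub_rows mxcol_mul.
  by apply: eq_mxcol => i; rewrite -UP /hankel word_idxK.
rewrite trans_word_rcons -(mulmxA (mA _ q)) vU (mulmxA (mA _ q)).
rewrite kalman_ho_shift mulmxA Om_Rshift mxcol_mul; apply: eq_mxcol => i.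
by rewrite -UP /hankel !word_idxK // cat_rcons.
Qed.

Lemma kalman_ho_markov v i j : S (j :: rcons v i) =
  mC (kalman_ho Om Rm) i *m trans_word (kalman_ho Om Rm) v *m
  mB (kalman_ho Om Rm) j.
Proof.
(* The output matrices sit in block row 0, which belongs to the empty word. *)
rewrite [mB _ _]/= [mC _ _]/= mul_submxrow -mulmxA !submxcol_mul kalman_ho_word.
by rewrite mxcolK -submxblockEv mxblockK cats0.
Qed.

End KalmanHo.

(** * Stationarity of spans of blocks indexed by words *)

Section WordChain.
Variables (R : realType) (D p n : nat).
Variables (F : seq 'I_D -> 'M[R]_(p, n)) (A : 'I_D -> 'M[R]_n).
Hypothesis D0 : (0 < D)%N.
Hypothesis F_cons : forall q v, F (q :: v) = F v *m A q.

(** [F] is kept abstract to serve both for observability and, after transposition and reversal of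
    words, for reachability. *)
Definition words_mx (k : nat) := \mxcol_(i < Nw D k) F (word D i).

Lemma words_mx_sub k v : (size v <= k)%N -> (F v <= words_mx k)%MS.
Proof.
move=> vk; have -> : F v = submxcol (words_mx k) (Ordinal (word_idx_lt vk)).
  by rewrite mxcolK word_idxK.
exact: rowsub_sub.
Qed.

Lemma words_mx_subP k a (X : 'M_(a, n)) :
  (forall v, (size v <= k)%N -> (F v <= X)%MS) -> (words_mx k <= X)%MS.
Proof.
move=> FX; apply/row_subP => i; rewrite row_mxcol.
by apply: submx_trans (row_sub _ _) (FX _ _); apply: size_word.
Qed.

(** Multiplication by [A q] lengthens a word by one letter, so the hypothesis makes the row space
    invariant under every [A q]. *)
Lemma words_mx_stable k : (words_mx k.+1 <= words_mx k)%MS ->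
  forall v, (F v <= words_mx k)%MS.
Proof.
move=> st; elim=> [|q v IH]; first exact: words_mx_sub.
rewrite F_cons; apply: submx_trans st; apply: submx_trans (submxMr _ IH) _.
rewrite mxcol_mul; apply/row_subP => i; rewrite row_mxcol -F_cons.
by apply: submx_trans (row_sub _ _) (words_mx_sub _); rewrite ltnS size_word.
Qed.

(** Each step before stationarity raises the rank by at least one. The strict inequality starts at k
    = 0, where rank zero forces all blocks to vanish. *)
Lemma words_mx_grow k :
  (k < \rank (words_mx k))%N \/ forall v, (F v <= words_mx k)%MS.
Proof.
elim: k => [|k [IH|IH]].
- case: (posnP (\rank (words_mx 0))) => [/eqP|]; last by left.
  rewrite mxrank_eq0 => /eqP C0; right; elim=> [|q v IH].
    exact: words_mx_sub.
  move: IH; rewrite F_cons C0 => IH.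
  by apply: submx_trans (submxMr (A q) IH) _; rewrite mul0mx sub0mx.
- have [st|st] := boolP (words_mx k.+1 <= words_mx k)%MS.
    right=> v; apply: submx_trans (words_mx_stable st v) _.
    by apply: words_mx_subP => s sk; apply/words_mx_sub/leqW.
  left; apply: leq_ltn_trans IH _; apply: rank_ltmx.
  rewrite ltmxE st andbT.
  by apply: words_mx_subP => s sk; apply/words_mx_sub/leqW.
- right=> v; apply: submx_trans (IH v) _.
  by apply: words_mx_subP => s sk; apply/words_mx_sub/leqW.
Qed.

(** A rank of at least k+1 fills the space of rows of length [n]; this is the source of the bound
    L+1 on the dimension. *)
Lemma words_mx_full k v : (n <= k.+1)%N -> (F v <= words_mx k)%MS.
Proof.
move=> nk; have [kr|] := words_mx_grow k; last exact.
by apply: submx_full; rewrite /row_full eqn_leq rank_leq_col (leq_trans nk).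
Qed.

End WordChain.

(** * Hankel matrices factored through the state space of a realization *)

Section RealizationRank.
Variables (R : realType) (D m r : nat) (S : seq 'I_D -> 'M[R]_(r, m)).
Variable Sg : alpv R D m r.
Hypothesis D0 : (0 < D)%N.
Hypothesis SE : forall v i j, S (j :: rcons v i) =
  mC Sg i *m trans_word Sg v *m mB Sg j.

Definition obs v := \mxcol_(q < D) (mC Sg q *m trans_word Sg v).

Definition reach v := \mxrow_(q < D) (trans_word Sg v *m mB Sg q).

Lemma hankel_obs_reach i j :
  hankel S i j = obs (word D i) *m reach (word D j).
Proof.
rewrite mul_mxcol_mxrow; apply: eq_mxblock => q q'.
by rewrite SE trans_word_cat !mulmxA.
Qed.

Lemma hankel_row_obs M i : hankel_row S M i =
  obs (word D i) *m \mxrow_(j < Nw D M) reach (word D j).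
Proof.
by rewrite mul_mxrow; apply: eq_mxrow => j; rewrite hankel_obs_reach.
Qed.

Lemma hankel_sub_obs L M : hankel_sub S L M =
  \mxcol_(i < Nw D L) obs (word D i) *m \mxrow_(j < Nw D M) reach (word D j).
Proof.
rewrite hankel_sub_rows mxcol_mul; apply: eq_mxcol => i.
exact: hankel_row_obs.
Qed.

Lemma rank_hankel_sub L M : (\rank (hankel_sub S L M) <= alpv_dim Sg)%N.
Proof.
by rewrite hankel_sub_obs (leq_trans (mxrankM_maxl _ _)) // rank_leq_col.
Qed.

Lemma obs_sub L v : (alpv_dim Sg <= L.+1)%N ->
  (obs v <= \mxcol_(i < Nw D L) obs (word D i))%MS.
Proof.
apply: (@words_mx_full _ _ _ _ obs (mA Sg)) => // q s.
by rewrite mxcol_mul; apply: eq_mxcol => i; rewrite mulmxA.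
Qed.

(** A new last letter multiplies [reach] on the left, whereas the chain needs a new first letter
    acting on the right; transposing and reversing words, which keeps their length, reconciles the
    two. *)
Lemma reach_sub L v : (alpv_dim Sg <= L.+1)%N ->
  ((reach v)^T <= (\mxrow_(j < Nw D L) reach (word D j))^T)%MS.
Proof.
move=> nL; rewrite -(revK v) [X in (_ <= X)%MS]tr_mxrow.
apply: submx_trans (words_mx_full (F := fun s => (reach (rev s))^T)
  (A := fun q => (mA Sg q)^T) D0 _ (rev v) nL) _.
  move=> q s; rewrite -trmx_mul rev_cons mul_mxrow; congr trmx.
  by apply: eq_mxrow => i; rewrite trans_word_rcons mulmxA.
apply: words_mx_subP => // s sL.
by apply: (words_mx_sub (fun s => (reach s)^T) D0); rewrite size_rev.
Qed.

(** Through the factorization, [reach_sub] expresses every block column by the first N(L) ones and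
    [obs_sub] extends relations to every block row. *)
Lemma realization_hankel_rank L : (alpv_dim Sg <= L.+1)%N ->
  Some (\rank (hankel_sub S L L)) = hankel_rank S.
Proof.
move=> nL; apply/hankel_rank_reduction; split=> [j|u u0 i].
  have /submxP [U UP] := reach_sub (word D j) nL.
  exists U^T => i; rewrite hankel_obs_reach hankel_row_obs -mulmxA.
  by congr (_ *m _); apply: trmx_inj; rewrite trmx_mul trmxK.
have /submxP [X XP] := obs_sub (word D i) nL.
by rewrite hankel_row_obs XP -(mulmxA X) -hankel_sub_obs -mulmxA u0 mulmx0.
Qed.

End RealizationRank.

Theorem theorem5 (R : realType) (D m r : nat)
    (D_gt0 : (0 < D)%N) (m_gt0 : (0 < m)%N) (r_gt0 : (0 < r)%N)
    (P : set 'cV[R]_D) (P_span : lspan P = setT)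
    (f : io_map m r P) (Sf : seq 'I_D -> 'M[R]_(r, m)) (f_gcr : is_gcr f Sf)
    (L : nat) :
  (Some (\rank (hankel_sub Sf L L)) = hankel_rank Sf ->
   forall (n : nat) (Om : 'M[R]_(\sum_(i < Nw D L) \sum_(q < D) r, n))
     (Rm : 'M[R]_(n, \sum_(j < Nw D L.+1) \sum_(q < D) m)),
   n = \rank (hankel_sub Sf L L.+1) ->
   hankel_sub Sf L L.+1 = Om *m Rm ->
   \rank Om = n -> \rank Rm = n ->
   minimal_realization f (kalman_ho Om Rm)) /\
  ((exists Sg : alpv R D m r, realization f Sg /\ (alpv_dim Sg <= L.+1)%N) ->
   Some (\rank (hankel_sub Sf L L)) = hankel_rank Sf).
Proof.
have realP := realizationP _ D_gt0 P_span f_gcr.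
split=> [rankE n Om Rm n_rank fact rank_Om _|[Sg [/realP SE nL]]]; last first.
  exact: realization_hankel_rank SE _ nL.
split=> [|Sg /realP SE].
  apply/realP => v i j; exact: kalman_ho_markov.
(* [n] is the rank of a Hankel block, which bounds the dimension of every realization from below. *)
by rewrite [alpv_dim (kalman_ho _ _)]n_rank (rank_hankel_sub SE).
Qed.
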